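(* Let $n\ge 2$ and let $\rho:\mathbb{C}^{n-1}\times\mathbb{R}\to\mathbb{R}$ be a smooth bounded function such that $$S=\{(z,w)\in\mathbb{C}^{n-1}\times\mathbb{C}: v=\rho(z,u)\},\qquad w=u+iv,$$ is a Levi-flat graph. Then $S$ is foliated by complex hyperplanes, i.e. $\rho$ has the form $\rho(z,u)=\varrho(u)$ for some smooth function $\varrho:\mathbb{R}\to\mathbb{R}$.
   Context: Holomorphic coordinates on $\mathbb{C}^n$ are $(z,w)=(z_1,\ldots,z_{n-1},w)$, $w=u+iv$. A smooth real hypersurface of $\mathbb{C}^n$ is Levi flat if it is foliated by (immersed) complex submanifolds of dimension $n-1$; equivalently, its Levi form vanishes identically. *)

(* Defs.v *)
From HB Require Import structures.
From mathcomp Require Import all_boot all_order all_algebra.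
From mathcomp Require Import all_classical all_reals all_analysis.
From mathcomp Require Import complex.

Set Implicit Arguments.
Unset Strict Implicit.
Unset Printing Implicit Defensive.

Import Order.TTheory GRing.Theory Num.Theory.
Import numFieldNormedType.Exports.

Local Open Scope classical_set_scope.
Local Open Scope ring_scope.
Local Open Scope complex_scope.

(* C^k regularity.  For finite-dimensional V, which is the only case used,
   this is the usual notion. *)
Fixpoint Ck (R : realType) (V : normedModType R) (k : nat) (f : V -> R) : Prop :=
  match k with
  | 0 => continuous f
  | k'.+1 => (forall x, differentiable f x) /\ (forall v, Ck k' ('D_v f))
  end.

Definition smooth (R : realType) (V : normedModType R) (f : V -> R) : Prop :=
  forall k, Ck k f.

(* The library provides no real normed space structure on C^N, so real calculus
   on C^N is done in the real coordinates p = x + iy. *)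
Definition to_real (R : realType) (N : nat) (p : 'rV[R[i]]_N) :
    'rV[R]_N * 'rV[R]_N :=
  (map_mx (@complex.Re R) p, map_mx (@complex.Im R) p).

Definition of_real (R : realType) (N : nat) (q : 'rV[R]_N * 'rV[R]_N) :
    'rV[R[i]]_N :=
  \row_j (q.1 0 j +i* q.2 0 j).

Definition smooth_on_C (R : realType) (N : nat) (f : 'rV[R[i]]_N -> R) : Prop :=
  smooth (f \o @of_real R N).

Definition smooth_on_CxR (R : realType) (N : nat)
    (f : 'rV[R[i]]_N -> R -> R) : Prop :=
  smooth (fun q : 'rV[R]_N * 'rV[R]_N * R => f (of_real q.1) q.2).

Section Wirtinger.
Variables (R : realType) (N : nat).
Implicit Types (f : 'rV[R[i]]_N -> R[i]) (r : 'rV[R[i]]_N -> R).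
Implicit Types (p t v : 'rV[R[i]]_N) (S : set 'rV[R[i]]_N).

(* Real directional derivative of a complex-valued function. *)
Definition rderive v f p : R[i] :=
  'D_(to_real v) (fun q => complex.Re (f (of_real q))) (to_real p)
  +i* 'D_(to_real v) (fun q => complex.Im (f (of_real q))) (to_real p).

Definition d_z (j : 'I_N) f p : R[i] :=
  (rderive (delta_mx 0 j) f p - 'i%C * rderive ('i%C *: delta_mx 0 j) f p) / 2.

Definition d_zbar (j : 'I_N) f p : R[i] :=
  (rderive (delta_mx 0 j) f p + 'i%C * rderive ('i%C *: delta_mx 0 j) f p) / 2.

Definition cplx_fun r p : R[i] := (r p)%:C.

Definition defining_function S r : Prop :=
  [/\ smooth_on_C r,
      S = [set p | r p = 0] &
      forall p, S p -> exists j, d_z j (cplx_fun r) p != 0].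

Definition complex_tangent r p : set 'rV[R[i]]_N :=
  [set t | \sum_j d_z j (cplx_fun r) p * t 0 j = 0].

Definition levi_form r p t : R[i] :=
  \sum_j \sum_k d_z j (d_zbar k (cplx_fun r)) p * t 0 j * ((t 0 k)^*)%C.

(* Smooth real hypersurfaces given by a global defining function, as graphs
   are.  Another defining function multiplies the Levi form by a nowhere zero
   real function, so its vanishing does not depend on the choice of r. *)
Definition levi_flat S : Prop :=
  (exists r, defining_function S r) /\
  forall r, defining_function S r ->
    forall p t, S p -> complex_tangent r p t -> levi_form r p t = 0.

End Wirtinger.

(* Points of C^m x C are row vectors of size m + 1. *)
Definition zpart (R : realType) (m : nat) (p : 'rV[R[i]]_(m + 1)) : 'rV[R[i]]_m :=
  lsubmx p.

Definition wpart (R : realType) (m : nat) (p : 'rV[R[i]]_(m + 1)) : R[i] :=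
  rsubmx p 0 0.

Definition graph (R : realType) (m : nat) (rho : 'rV[R[i]]_m -> R -> R) :
    set 'rV[R[i]]_(m + 1) :=
  [set p | complex.Im (wpart p) = rho (zpart p) (complex.Re (wpart p))].

Definition hyperplane (R : realType) (m : nat) (c : R[i]) :
    set 'rV[R[i]]_(m + 1) :=
  [set p | wpart p = c].

(* Main.v *)
Require Import Defs.
From HB Require Import structures.
From mathcomp Require Import all_boot all_order all_algebra.
From mathcomp Require Import all_classical all_reals all_analysis.
From mathcomp Require Import complex.
From mathcomp Require Import ring lra.
Import Order.TTheory GRing.Theory Num.Theory.
Import numFieldNormedType.Exports.
Local Open Scope classical_set_scope.
Local Open Scope ring_scope.
Local Open Scope complex_scope.

Set Implicit Arguments.
Unset Strict Implicit.
Unset Printing Implicit Defensive.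

(* It suffices to treat z in one complex line.  Let p be a point of the w-plane
   at positive distance from every slice S_z = {(u, rho(z, u))}.  Along the
   leaves w is a holomorphic function of z, so log |w - p| is harmonic there and
   z |-> log dist(p, S_z), a minimum of such functions, is superharmonic and
   bounded below on C; by Liouville it is constant.  The leaves are never
   constructed: at a minimum of log |w - p|^2 + e (log |z - z1|^2 - |z - z1|^-2)
   the second derivative test along the two real directions of the complex
   tangent line, where the Levi form vanishes, is already contradictory.
   Finally, let v0 be the infimum of the v such that u0 + iv lies above every
   S_z at positive distance.  If some S_z avoided u0 + i v0, then a point
   slightly above u0 + i v0 would be far from that slice, hence equally far from
   all of them, and one could go below v0.  So every S_z contains u0 + i v0. *)

(** * Second-order jets of functions of one real variable *)

Section Jet.
Context {R : realType}.
Implicit Types (f g : R -> R) (a b c d : R).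

(** The numbers [a] and [b] are the first and second derivatives of [f] at 0. As a relation it is
    closed under sums, products and logarithms, and it asks for the second derivative at 0 alone. *)
Definition jet2 f a b : Prop :=
  exists2 f' : R -> R, (\forall t \near (0 : R), is_derive (t : R) 1 f (f' t)) &
    f' 0 = a /\ is_derive (0 : R) 1 f' b.

Lemma jet2_id c d : jet2 (fun t => c + d * t) d 0.
Proof.
exists (cst d); last by split=> //; exact: is_derive_cst.
near=> t; apply: is_derive_eq; rewrite /=.
rewrite /GRing.scale /=; ring.
Unshelve. all: by end_near. Qed.

Lemma jet2D f g a b c d : jet2 f a b -> jet2 g c d ->
  jet2 (fun t => f t + g t) (a + c) (b + d).
Proof.
move=> [f' ff' [<- f'b]] [g' gg' [<- g'd]].
exists (fun t => f' t + g' t); last by split=> //; exact: is_deriveD.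
near=> t; apply: is_deriveD.
- by near: t.
- by near: t.
Unshelve. all: by end_near. Qed.

Lemma jet2M f g a b c d : jet2 f a b -> jet2 g c d ->
  jet2 (fun t => f t * g t) (f 0 * c + g 0 * a)
    (f 0 * d + g 0 * b + 2 * a * c).
Proof.
move=> [f' ff' [<- f'b]] [g' gg' [<- g'd]].
exists (fun t => f t * g' t + g t * f' t).
  near=> t; apply: is_deriveM.
  - by near: t.
  - by near: t.
split=> //.
have Df : is_derive (0:R) 1 f (f' 0) by exact: nbhs_singleton ff'.
have Dg : is_derive (0:R) 1 g (g' 0) by exact: nbhs_singleton gg'.
apply: is_derive_eq; rewrite /= /GRing.scale /=; ring.
Unshelve. all: by end_near. Qed.

Lemma jet2_eq f a b c d : a = c -> b = d -> jet2 f a b -> jet2 f c d.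
Proof. by move=> -> ->. Qed.

Lemma jet2Z k f a b : jet2 f a b -> jet2 (fun t => k * f t) (k * a) (k * b).
Proof.
move=> /(jet2M (jet2_id k 0)) /=.
rewrite (_ : (fun t => _) = (fun t => k * f t)); last first.
  by apply/funext => t; rewrite mul0r addr0.
by apply: jet2_eq; ring.
Qed.

Lemma jet2_sqr c f a b : jet2 f a b ->
  jet2 (fun t => (f t - c) ^+ 2) (2 * (f 0 - c) * a)
    (2 * a ^+ 2 + 2 * (f 0 - c) * b).
Proof.
move=> jf; have jc := jet2D jf (jet2_id (- c) 0).
have := jet2M jc jc.
rewrite (_ : (fun t => _) = (fun t => (f t - c) ^+ 2)); last first.
  by apply/funext => t; rewrite mul0r addr0 -expr2.
by apply: jet2_eq; ring.
Qed.

Lemma jet2_near_gt0 f a b : jet2 f a b -> 0 < f 0 -> \forall t \near (0:R), 0 < f t.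
Proof.
move=> [f' ff' _] f0.
have /derivable1_diffP/differentiable_continuous cf : derivable f 0 1.
  by case: (nbhs_singleton ff').
exact: (cvgr_gt (f 0) cf).
Qed.

Lemma jet2V f a b : 0 < f 0 -> jet2 f a b ->
  jet2 (fun t => (f t)^-1) (- a / f 0 ^+ 2)
    (- b / f 0 ^+ 2 + 2 * a ^+ 2 / f 0 ^+ 3).
Proof.
move=> f0 fab; have fpos := jet2_near_gt0 fab f0.
have [f' ff' [<- f'b]] := fab.
exists (fun t => - (f t) ^- 2 * f' t).
  near=> t; apply: is_deriveV.
  - by rewrite gt_eqF//; near: t.
  - by near: t.
split; first by field; rewrite gt_eqF.
have Df : is_derive (0:R) 1 f (f' 0) by exact: nbhs_singleton ff'.
have Dfi : is_derive (0:R) 1 (fun t => (f t)^-1) (- (f 0) ^- 2 *: f' 0).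
  by apply: is_deriveV => //; rewrite gt_eqF.
rewrite (_ : (fun t => _) = (fun t => - ((f t)^-1 * (f t)^-1 * f' t))); last first.
  by apply/funext => t; rewrite -invfM expr2 mulNr.
apply: is_derive_eq; rewrite /= /GRing.scale /=; field; by rewrite gt_eqF.
Unshelve. all: by end_near. Qed.

Lemma jet2_ln f a b : 0 < f 0 -> jet2 f a b ->
  jet2 (fun t => ln (f t)) (a / f 0) (b / f 0 - (a / f 0) ^+ 2).
Proof.
move=> f0 fab; have fpos := jet2_near_gt0 fab f0.
have [f' ff' [<- f'b]] := fab.
exists (fun t => (f t)^-1 * f' t).
  near=> t; apply: (@is_derive1_comp _ (@ln R) f).
  - by apply: is_derive1_ln; near: t.
  - by near: t.
split; first by rewrite mulrC.
have Df : is_derive (0:R) 1 f (f' 0) by exact: nbhs_singleton ff'.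
have Dfi : is_derive (0:R) 1 (fun t => (f t)^-1) (- (f 0) ^- 2 *: f' 0).
  by apply: is_deriveV => //; rewrite gt_eqF.
apply: is_derive_eq; rewrite /= /GRing.scale /=; field; by rewrite gt_eqF.
Unshelve. all: by end_near. Qed.

(** Fermat's theorem gives [f' 0 = 0]. If [b < 0], the difference quotients of [f'] at 0 make [f']
    negative just to the right of 0, and the mean value theorem puts [f] below [f 0] there. *)
Lemma jet2_local_min f a b : jet2 f a b -> (\forall t \near (0:R), f 0 <= f t) ->
  0 <= b.
Proof.
move=> [f' ff' [f'0 f'b]] fmin.
have [e /= e0 He] : \forall t \near (0:R), is_derive (t : R) 1 f (f' t) /\ f 0 <= f t.
  by near=> t; split; near: t.
have ball t : - e < t < e -> is_derive (t : R) 1 f (f' t) /\ f 0 <= f t.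
  by move=> te; apply: He; rewrite /ball_ /= sub0r normrN ltr_norml.
have f'00 : f' 0 = 0.
  have e0' : - e <= e by lra.
  have der t : t \in `]- e, e[ -> derivable f t 1.
    by rewrite in_itv /= => /ball[[]].
  have min0 t : t \in `]- e, e[ -> f 0 <= f t by rewrite in_itv /= => /ball[].
  have in0 : 0 \in `]- e, e[ by rewrite in_itv /= oppr_lt0 e0.
  have [_ D0] := derive1_at_min e0' der in0 min0.
  by have [[_ D0'] _] := ball 0 ltac:(lra); rewrite -D0' D0.
rewrite leNgt; apply/negP => b0.
have [cvf' Db] := f'b.
have cvb : (fun h : R => h^-1 *: ((f' \o shift 0) (h *: 1) - f' 0)) @ 0^' --> b.
  by rewrite -Db.
have := cvgr_lt b cvb _ b0.
rewrite near_withinE => -[d /= d0 Hd].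
pose h := Num.min d e / 2.
have hd : 0 < h < d /\ h < e.
  rewrite /h; have [de|de] := leP d e; split; lra.
have [] := @MVT R f f' 0 h.
- by lra.
- by move=> x; rewrite in_itv /= => xh; apply: (ball _ _).1; lra.
- apply: derivable_within_continuous => x; rewrite in_itv /= => xh.
  by have [[]] := ball x ltac:(lra).
move=> c; rewrite in_itv /= => ch fc.
have := Hd c; rewrite /ball_ /= sub0r normrN gtr0_norm; last by lra.
move=> /(_ ltac:(lra) ltac:(by rewrite gt_eqF; lra)).
rewrite f'00 subr0 addr0 [_ *: 1]mulr1 [_ *: _]/(_ * _).
have c0 : 0 < c^-1 by rewrite invr_gt0; lra.
rewrite pmulr_rlt0 // => f'c.
have [_] := ball h ltac:(lra).
have : f' c * (h - 0) < 0 by rewrite nmulr_rlt0; lra.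
by lra.
Unshelve. all: by end_near. Qed.

End Jet.

(** * Liouville property of the distance to the slices *)

(** The part of [A] inside a closed cube is compact, so [f] has a minimum there; at points of [A]
    outside the cube [f] exceeds [f q0]. *)
Lemma continuous_min_bounded {R : realType} (f : R * R * R -> R)
    (A : set (R * R * R)) (q0 : R * R * R) (B : R) :
  closed A -> {in A, continuous f} -> A q0 ->
  (forall q, A q -> f q <= f q0 -> [/\ `|q.1.1| <= B, `|q.1.2| <= B & `|q.2| <= B]) ->
  exists2 q, A q & forall q', A q' -> f q <= f q'.
Proof.
move=> cA cf Aq0 fB.
pose I := `[- B, B]%classic.
have cI : compact I by exact: segment_compact.
have cK : compact ((I `*` I `*` I) `&` A).
  by apply: compact_closedI => //; do 2![apply: compact_setX => //].
have K0 : (I `*` I `*` I `&` A) q0.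
  by split=> //; have [] := fB _ Aq0 (lexx _); rewrite !ler_norml.
have [||q] := @compact_EVT_min _ R f _ _ cK.
- by exists q0.
- by apply: continuous_in_subspaceT => q; rewrite inE => -[_ Aq]; apply: cf; rewrite inE.
rewrite inE => -[_ Aq] qmin; exists q => // q' Aq'.
have [fq'|/ltW fq'] := leP (f q') (f q0).
  apply: qmin; rewrite inE; split => //.
  by have [] := fB _ Aq' fq'; rewrite !ler_norml.
by apply: le_trans fq'; apply: qmin; rewrite inE.
Qed.

Lemma norm_le_of_sqr {R : realType} (a c K : R) :
  (a - c) ^+ 2 <= K -> `|a| <= K + 1 + `|c|.
Proof.
move=> h; have : `|a| <= `|a - c| + `|c| by rewrite -{1}(subrK c a) ler_normD.
have : `|a - c| ^+ 2 <= K by rewrite real_normK ?num_real.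
by nra.
Qed.

Lemma continuous_sqrDsqr {R : realType} {T : topologicalType} (f g : T -> R)
    (c d : R) : continuous f -> continuous g ->
  continuous (fun q => (f q - c) ^+ 2 + (g q - d) ^+ 2).
Proof.
move=> cf cg q; apply: cvgD.
- rewrite expr2 (_ : (fun q => _) = (fun q => (f q - c) * (f q - c))) //.
  by apply: cvgM; apply: cvgB; [exact: cf|exact: cvg_cst|exact: cf|exact: cvg_cst].
- rewrite expr2 (_ : (fun q => _) = (fun q => (g q - d) * (g q - d))) //.
  by apply: cvgM; apply: cvgB; [exact: cg|exact: cvg_cst|exact: cg|exact: cvg_cst].
Qed.

Section Liouville.
Context {R : realType}.
Variable rho : R -> R -> R -> R.
Hypothesis rho_continuous : continuous (fun q : R * R * R => rho q.1.1 q.1.2 q.2).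
(* [(1, a - i c)] is the complex tangent direction: the two first derivatives
   are the Cauchy-Riemann equations, and the two second derivatives add up to
   the Levi form in that direction. *)
Hypothesis rho_flat : forall x y u, exists a c b : R,
  jet2 (fun t => rho (x + t) y (u + a * t)) (- c) b /\
  jet2 (fun t => rho x (y + t) (u + c * t)) a (- b).
Variables p1 p2 : R.

(** The centre is [p1 + i p2] in the w-plane; the infimum over [u] is the squared distance from it
    to the slice over [x + i y]. *)
Definition sqdist_graph (x y u : R) : R := (u - p1) ^+ 2 + (rho x y u - p2) ^+ 2.

Definition sqdist2 (x1 y1 x y : R) : R := (x - x1) ^+ 2 + (y - y1) ^+ 2.

Lemma sqdist_graph_continuous :
  continuous (fun q : R * R * R => sqdist_graph q.1.1 q.1.2 q.2).
Proof.
apply: continuous_sqrDsqr; last exact: rho_continuous.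
by move=> q; exact: cvg_snd.
Qed.

Lemma sqdist2_continuous x1 y1 :
  continuous (fun q : R * R * R => sqdist2 x1 y1 q.1.1 q.1.2).
Proof.
apply: continuous_sqrDsqr => q.
- by apply: (cvg_comp fst fst); exact: cvg_fst.
- by apply: (cvg_comp fst snd); [exact: cvg_fst|exact: cvg_snd].
Qed.

(* [ln (sqdist_graph _ _ _)] has zero Laplacian along the tangent direction and
   [ln (sqdist2 _ _ _ _)] is harmonic; the term [- (sqdist2 _ _ _ _)^-1] makes
   the sum strictly superharmonic. *)
Lemma log_sqdist_no_exterior_min x y u x1 y1 e r :
  0 < sqdist_graph x y u -> 0 < e -> 0 < r < sqdist2 x1 y1 x y ->
  ~ (forall x' y' u', r < sqdist2 x1 y1 x' y' ->
     ln (sqdist_graph x y u) +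
       e * (ln (sqdist2 x1 y1 x y) - (sqdist2 x1 y1 x y)^-1) <=
     ln (sqdist_graph x' y' u') +
       e * (ln (sqdist2 x1 y1 x' y') - (sqdist2 x1 y1 x' y')^-1)).
Proof.
move=> Q0 e0 /andP[r0 rN] Gmin.
have N0 := lt_trans r0 rN.
pose G x y u := ln (sqdist_graph x y u) +
  e * (ln (sqdist2 x1 y1 x y) - (sqdist2 x1 y1 x y)^-1).
(* Second derivative test for [G] on the line of velocity [(dx, dy, du)], using
   [(ln Q)'' = Q''/Q - (Q'/Q)^2] and [(1/N)'' = - N''/N^2 + 2 N'^2/N^3]. *)
have along dx dy du dv ddv :
    jet2 (fun t => rho (x + dx * t) (y + dy * t) (u + du * t)) dv ddv ->
    0 <= (2 * (du ^+ 2 + dv ^+ 2 + (rho x y u - p2) * ddv)) / sqdist_graph x y u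
      - (2 * ((u - p1) * du + (rho x y u - p2) * dv) / sqdist_graph x y u) ^+ 2
      + e * (2 * (dx ^+ 2 + dy ^+ 2) / sqdist2 x1 y1 x y
        - (2 * ((x - x1) * dx + (y - y1) * dy) / sqdist2 x1 y1 x y) ^+ 2
        + 2 * (dx ^+ 2 + dy ^+ 2) / sqdist2 x1 y1 x y ^+ 2
        - 2 * (2 * ((x - x1) * dx + (y - y1) * dy)) ^+ 2
          / sqdist2 x1 y1 x y ^+ 3).
  move=> jv.
  set N := sqdist2 x1 y1 x y in rN N0 *; set Q := sqdist_graph x y u in Q0 *.
  pose X t := x + dx * t; pose Y t := y + dy * t; pose U t := u + du * t.
  have X0 : X 0 = x by rewrite /X mulr0 addr0.
  have Y0 : Y 0 = y by rewrite /Y mulr0 addr0.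
  have U0 : U 0 = u by rewrite /U mulr0 addr0.
  set N' := 2 * ((x - x1) * dx + _); set N'' := 2 * (dx ^+ 2 + _).
  set Q' := 2 * ((u - p1) * du + _); set Q'' := 2 * (du ^+ 2 + _ + _).
  have jN : jet2 (fun t => sqdist2 x1 y1 (X t) (Y t)) N' N''.
    have := jet2D (jet2_sqr x1 (jet2_id x dx)) (jet2_sqr y1 (jet2_id y dy)).
    by apply: jet2_eq; rewrite /N' /N''; ring.
  have jQ : jet2 (fun t => sqdist_graph (X t) (Y t) (U t)) Q' Q''.
    have := jet2D (jet2_sqr p1 (jet2_id u du)) (jet2_sqr p2 jv).
    by apply: jet2_eq; rewrite ?mulr0 ?addr0 /Q' /Q''; ring.
  have jG : jet2 (fun t => G (X t) (Y t) (U t))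
      (Q' / Q + e * (N' / N + N' / N ^+ 2))
      (Q'' / Q - (Q' / Q) ^+ 2 +
      e * (N'' / N - (N' / N) ^+ 2 + N'' / N ^+ 2 - 2 * N' ^+ 2 / N ^+ 3)).
    have jlQ := jet2_ln _ jQ; have jlN := jet2_ln _ jN; have jVN := jet2V _ jN.
    rewrite X0 Y0 ?U0 in jlQ, jlN, jVN.
    have := jet2D (jlQ Q0) (jet2Z e (jet2D (jlN N0) (jet2Z (- 1) (jVN N0)))).
    rewrite (_ : (fun t => _) = (fun t => G (X t) (Y t) (U t))); last first.
      by apply/funext => t; rewrite mulN1r.
    by apply: jet2_eq; rewrite -/N -/Q; field; rewrite ?gt_eqF.
  apply: jet2_local_min jG _.
  (* Minimality is known only outside the disc; the line stays outside for small [t]. *)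
  have := jet2_near_gt0 (jet2D jN (jet2_id (- r) 0)).
  rewrite /= X0 Y0 mul0r addr0 subr_gt0 => /(_ rN) near_r.
  near=> t; rewrite U0; apply: Gmin.
  have : 0 < sqdist2 x1 y1 (X t) (Y t) + (- r + 0 * t) by near: t.
  by rewrite mul0r addr0 subr_gt0.
have [a [c [b [jx jy]]]] := rho_flat x y u.
(* The real directions [(1, a - i c)] and [i (1, a - i c) = (i, c + i a)]; their second-order terms
   [b] and [- b] cancel in the sum. *)
have := along 1 0 a (- c) b; have := along 0 1 c a (- b).
rewrite (_ : (fun t => _) = (fun t => rho x (y + t) (u + c * t))); last first.
  by apply/funext => t; rewrite mul0r addr0 mul1r.
rewrite (_ : (fun t => rho (x + 1 * t) _ _) = (fun t => rho (x + t) y (u + a * t))); last first.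
  by apply/funext => t; rewrite mul0r addr0 mul1r.
move=> /(_ jy) hy /(_ jx) hx; have := addr_ge0 hx hy; apply/negP.
rewrite -ltNge.
set S := (X in X < 0).
(* The two logarithms contribute zero. The term [- 1/N] contributes [4/N^2 - 8/N^2], times [e]. *)
have -> : S = - (4 * e / sqdist2 x1 y1 x y ^+ 2).
  rewrite /S; move: Q0 N0; rewrite /sqdist_graph /sqdist2 => Q0 N0.
  by field; rewrite ?gt_eqF.
by rewrite oppr_lt0 divr_gt0 ?exprn_gt0 ?mulr_gt0.
Unshelve. all: by end_near. Qed.

(** Otherwise the slice over [z1] is farther from the centre than some point over [z0], and so, by a
    margin, are the slices over a small disc about [z1]. Outside the disc a logarithmic perturbation
    of [ln Q] attains its minimum, which can lie neither in the open exterior nor on the circle. *)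
Lemma sqdist_graph_liouville g :
  0 < g -> (forall x y u, g <= sqdist_graph x y u) ->
  forall x1 y1 x0 y0 u0, exists u, sqdist_graph x1 y1 u <= sqdist_graph x0 y0 u0.
Proof.
move=> g0 gQ x1 y1 x0 y0 u0; set Q0 := sqdist_graph x0 y0 u0.
apply: contrapT => /forallNP noQ1.
have Q1 u : Q0 < sqdist_graph x1 y1 u.
  by rewrite ltNge; apply/negP; exact: noQ1.
pose N (q : R * R * R) := sqdist2 x1 y1 q.1.1 q.1.2.
pose Q (q : R * R * R) := sqdist_graph q.1.1 q.1.2 q.2.
have cN : continuous N by exact: sqdist2_continuous.
have cQ : continuous Q by exact: sqdist_graph_continuous.
have closed_Nle c : closed [set q | N q <= c].
  exact: (proj1 (continuous_closedP _) cN _ (@closed_le R c)).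
have closed_Nge c : closed [set q | c <= N q].
  exact: (proj1 (continuous_closedP _) cN _ (@closed_ge R c)).
have closed_Qle c : closed [set q | Q q <= c].
  exact: (proj1 (continuous_closedP _) cQ _ (@closed_le R c)).
pose B c d : R := Num.max c d + 1 + (`|x1| + `|y1| + `|p1|).
have bound c d q : N q <= c -> Q q <= d ->
    [/\ `|q.1.1| <= B c d, `|q.1.2| <= B c d & `|q.2| <= B c d].
  rewrite /N /Q /sqdist2 /sqdist_graph => Nc Qd.
  have := sqr_ge0 (q.1.1 - x1); have := sqr_ge0 (q.1.2 - y1).
  have := sqr_ge0 (q.2 - p1); have := sqr_ge0 (rho q.1.1 q.1.2 q.2 - p2).
  move=> s1 s2 s3 s4.
  have cm : c <= Num.max c d by rewrite le_max lexx.
  have dm : d <= Num.max c d by rewrite le_max lexx orbT.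
  have := normr_ge0 x1; have := normr_ge0 y1; have := normr_ge0 p1.
  move=> n1 n2 n3; split.
  - have := @norm_le_of_sqr _ q.1.1 x1 (Num.max c d); rewrite /B; lra.
  - have := @norm_le_of_sqr _ q.1.2 y1 (Num.max c d); rewrite /B; lra.
  - have := @norm_le_of_sqr _ q.2 p1 (Num.max c d); rewrite /B; lra.
have Nq1 u : N (x1, y1, u) = 0 by rewrite /N /sqdist2 /= !subrr expr0n addr0.
have N_eq0 q : N q = 0 -> q = (x1, y1, q.2).
  move: q => [[x y] u]; rewrite /N /sqdist2 /= => /eqP.
  rewrite paddr_eq0 ?sqr_ge0 // !sqrf_eq0 !subr_eq0 => /andP[/eqP-> /eqP->].
  by [].
have N_ge0 q : 0 <= N q by rewrite addr_ge0 ?sqr_ge0.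
(* The minimum of [N] on the compact set where [N <= 1] and [Q <= Q0] is positive, since [Q > Q0]
   over [z1]; half of it serves as [s]. If that set is empty, [s = 1] does. *)
have [s s0 sQ] : exists2 s, 0 < s & forall q, N q <= s -> Q0 < Q q.
  have [[qK NqK QqK]|noK] := pselect (exists2 q, N q <= 1 & Q q <= Q0); last first.
    exists 1 => // q Nq; rewrite ltNge; apply/negP => Qq; apply: noK.
    by exists q.
  have [|||q|q [/= Nq Qq] qmin] := @continuous_min_bounded _ N
      ([set q | N q <= 1] `&` [set q | Q q <= Q0]) qK
      (B 1 Q0).
  - exact: closedI.
  - by move=> q _; exact: cN.
  - by [].
  - by move=> [/= + + _]; exact: bound.
  have Nq0 : 0 < N q.
    rewrite lt_neqAle N_ge0 andbT eq_sym; apply/eqP => /N_eq0 qE.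
    by move: Qq; rewrite leNgt qE => /negP; apply; exact: Q1.
  exists (N q / 2) => [|q' Nq']; first by rewrite divr_gt0.
  rewrite ltNge; apply/negP => Qq'.
  have := qmin q'; rewrite /= => /(_ (conj _ Qq')).
  have -> : N q' <= 1 by lra.
  by move=> /(_ isT); lra.
have [m Q0m mQ] : exists2 m, Q0 < m & forall q, N q <= s -> m <= Q q.
  have [|||q|q /= Nq qmin] := @continuous_min_bounded _ Q [set q | N q <= s]
      (x1, y1, 0) (B s (Q (x1, y1, 0))).
  - exact: closed_Nle.
  - by move=> q _; exact: cQ.
  - by rewrite /= Nq1 ltW.
  - exact: bound.
  by exists (Q q) => //; exact: sQ.
pose h n : R := ln n - n^-1.
pose q0 := (x0, y0, u0) : R * R * R.
have sN0 : s < N q0.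
  by rewrite ltNge; apply/negP => /sQ; rewrite ltxx.
have Q00 : 0 < Q0 by exact: lt_le_trans (gQ _ _ _).
have Q_gt0 q : 0 < Q q by exact: lt_le_trans (gQ _ _ _).
have lnQ0m : ln Q0 < ln m by rewrite ltr_ln ?posrE // (lt_trans Q00).
(* The perturbation must be too weak to close the gap between [ln Q0] and the bound [ln m] on the
   circle. *)
have [e e0 eh] : exists2 e, 0 < e & e * (h (N q0) - h s) < ln m - ln Q0.
  have [hs|hs] := leP (h (N q0)) (h s).
    by exists 1 => //; rewrite mul1r; lra.
  exists ((ln m - ln Q0) / (h (N q0) - h s) / 2).
    by rewrite !divr_gt0 ?subr_gt0.
  by rewrite mulrAC divfK; [lra|rewrite subr_eq0 gt_eqF].
pose G q := ln (Q q) + e * h (N q).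
have hle n : s <= n -> h s <= h n.
  move=> sn; rewrite /h lerB ?ler_ln ?posrE ?(lt_le_trans s0) //.
  by rewrite lef_pV2 ?posrE ?(lt_le_trans s0).
(* Bounds for [N] and [Q] where [G q <= G q0]: [ln Q >= ln g] and [1/N <= 1/s] bound [N] by [c1],
   and [h N >= h s] bounds [Q] by [d1]. *)
pose c1 := expR ((G q0 - ln g) / e + s^-1).
pose d1 := expR (G q0 - e * h s).
have [|||q sN Gq|q /= sN qmin] := @continuous_min_bounded _ G [set q | s <= N q] q0
      (B c1 d1).
- exact: closed_Nge.
- move=> q; rewrite inE /= => sN; have N0 := lt_le_trans s0 sN.
  apply: cvgD; first by apply: continuous_comp (cQ q) _; exact: continuous_ln.
  apply: cvgM; first exact: cvg_cst.
  apply: cvgB; first by apply: continuous_comp (cN q) _; exact: continuous_ln.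
  by apply: cvgV; [rewrite gt_eqF|exact: cN].
- by rewrite /= ltW.
- have N0 : 0 < N q := lt_le_trans s0 sN.
  have Nhs := hle _ sN.
  apply: bound.
  + rewrite -(lnK N0) ler_expR.
    have : ln g <= ln (Q q) by rewrite ler_ln ?posrE //; exact: gQ.
    have : (N q)^-1 <= s^-1 by rewrite lef_pV2 ?posrE.
    move=> Ns lg; rewrite -lerBlDr ler_pdivlMr //.
    have : (ln (N q) - s^-1) * e <= e * h (N q).
      by rewrite mulrC ler_pM2l // /h; lra.
    by move: Gq; rewrite {1}/G; lra.
  + rewrite -(lnK (Q_gt0 q)) ler_expR.
    have : e * h s <= e * h (N q) by rewrite ler_pM2l.
    by move: Gq; rewrite {1}/G; lra.
have [sN'|Ns] := ltP s (N q).
  apply: (@log_sqdist_no_exterior_min q.1.1 q.1.2 q.2 x1 y1 e s) => //.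
  - exact: Q_gt0.
  - by apply/andP.
  - by move=> x' y' u' sN''; apply: (qmin (x', y', u')); exact: ltW.
(* On the circle [Q q >= m], so [G q] is at least [ln m + e * h s], which exceeds [G q0] by the
   choice of [e]. *)
have NqE : N q = s by apply/eqP; rewrite eq_le sN Ns.
have := qmin q0 (ltW sN0); rewrite /G NqE -/Q0 => Gq.
have : ln m <= ln (Q q) by rewrite ler_ln ?posrE // ?(lt_trans Q00) //; apply: mQ; rewrite NqE.
have : ln (Q q0) = ln Q0 by [].
move: eh; rewrite mulrBr; lra.
Qed.

End Liouville.

(** * Bounded flat graphs over one complex line *)

Lemma flat_bounded_graph_constant {R : realType} (rho : R -> R -> R -> R) (M : R) :
  continuous (fun q : R * R * R => rho q.1.1 q.1.2 q.2) ->
  (forall x y u, exists a c b : R,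
    jet2 (fun t => rho (x + t) y (u + a * t)) (- c) b /\
    jet2 (fun t => rho x (y + t) (u + c * t)) a (- b)) ->
  (forall x y u, `|rho x y u| <= M) ->
  forall x y u, rho x y u = rho 0 0 u.
Proof.
move=> rho_continuous rho_flat rhoM.
suff rho_inf u0 : exists v0, forall x y, rho x y u0 = v0.
  by move=> x y u; have [v0 E] := rho_inf u; rewrite !E.
pose A : set R := [set v | (forall x y, rho x y u0 < v) /\
  exists2 g, 0 < g & forall x y u, g <= sqdist_graph rho u0 v x y u].
have A0 : A !=set0.
  exists (M + 1); split=> [x y|].
    by have := rhoM x y u0; rewrite ler_norml; lra.
  exists 1 => // x y u; rewrite /sqdist_graph.
  have := rhoM x y u; rewrite ler_norml => /andP[_ rM].
  have := sqr_ge0 (u - u0); nra.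
have lbA x y : lbound A (rho x y u0) by move=> v [/(_ x y)/ltW].
have infA : has_inf A by split=> //; exists (rho 0 0 u0); exact: lbA.
(* Every [rho x y u0] is a lower bound of [A], so only [inf A <= rho x2 y2 u0] remains. *)
exists (inf A) => x2 y2; apply/eqP; rewrite eq_le lb_le_inf //=.
rewrite leNgt; apply/negP => rho_lt.
have cu : continuous (rho x2 y2).
  move=> u; apply: (@continuous_comp _ _ _ (fun u => (x2, y2, u) : R * R * R)
    (fun q : R * R * R => rho q.1.1 q.1.2 q.2)); last exact: rho_continuous.
  have := @cvg_pair R (R * R)%type R (nbhs u) (nbhs ((x2, y2) : R * R)%type) (nbhs u) _ _ _
    (fun=> (x2, y2)) id.
  by apply; [exact: cvg_cst|exact: cvg_id].
pose c := (rho x2 y2 u0 + inf A) / 2.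
have [e /= e0 He] : \forall u \near u0, rho x2 y2 u < c.
  by apply: (cvgr_lt _ (cu u0)); rewrite /c; lra.
pose d := Num.min e (inf A - c).
have d0 : 0 < d by rewrite lt_min e0 /c; lra.
have de : d <= e by rewrite ge_min lexx.
have dc : d <= inf A - c by rewrite ge_min lexx orbT.
have [v Av vd] := inf_adherent (divr_gt0 d0 (ltr0Sn _ 3)) infA.
have infv : inf A <= v by apply: ge_inf => //; case: infA.
(* Within [e] of [u0] the slice stays below [c], at vertical distance at least [d] from [v]; farther
   away the horizontal distance is at least [e >= d]. *)
have gap2 u : d ^+ 2 <= sqdist_graph rho u0 v x2 y2 u.
  rewrite /sqdist_graph.
  have s1 := sqr_ge0 (u - u0); have s2 := sqr_ge0 (rho x2 y2 u - v).
  have [ue|ue] := ltP `|u0 - u| e.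
    have := He u ue => rc.
    by nra.
  have : d ^+ 2 <= (u - u0) ^+ 2.
    rewrite -[leRHS]real_normK ?num_real // distrC.
    by have := le_trans de ue; nra.
  by lra.
have [vpos [g g0 gv]] := Av.
(* The Liouville property carries the gap of one slice to all. The positive [g] from [A v] may be
   far smaller than [d ^+ 2]. *)
have gap x y u : d ^+ 2 <= sqdist_graph rho u0 v x y u.
  have [u' hu'] := sqdist_graph_liouville rho_continuous rho_flat g0 gv x2 y2 x y u.
  exact: le_trans hu'.
(* Descending by [d / 2] keeps a distance of at least [d / 2], yet goes below [inf A] because
   [v < inf A + d / 4]. *)
have Av' : A (v - d / 2).
  split=> [x y|].
    have := gap x y u0; rewrite /sqdist_graph subrr expr0n add0r.
    by have := vpos x y; nra.
  exists (d ^+ 2 / 4) => [|x y u]; first by rewrite divr_gt0 ?exprn_gt0.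
  have := gap x y u; rewrite /sqdist_graph.
  set a := u - u0; set r := rho x y u => ga.
  (* If [r - v > - d], the new squared distance is at least [d^2 + d (r - v) + d^2/4], hence at
     least [d^2/4]. *)
  have [rd|rd] := leP (r - v) (- d).
    by have := sqr_ge0 a; nra.
  by nra.
have : inf A <= v - d / 2 by apply: ge_inf => //; case: infA.
by lra.
Qed.

(** * Regularity and directional derivatives *)

Section Ck.
Context {R : realType}.
Implicit Types V W : normedModType R.

Lemma derive_comp_linear V W (L : V -> W) (f : W -> R) (v x : V) : linear L ->
  'D_v (f \o L) x = 'D_(L v) f (L x).
Proof.
move=> linL; have LE a y z : L (a *: y + z) = a *: L y + L z := linL a y z.
rewrite /derive; set g := fun h => _; set g' := fun h => _.
suff -> : g = g' by [].
by apply/funext => h; rewrite /g /g' /= LE.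
Qed.

Lemma deriveDl V (f : V -> R) (x v w : V) (a : R) : differentiable f x ->
  'D_(v + a *: w) f x = 'D_v f x + a * 'D_w f x.
Proof. by move=> df; rewrite !deriveE // linearD linearZ_LR. Qed.

Lemma differentiable_linear V W (L : V -> W) (x : V) :
  linear L -> continuous L -> differentiable L x.
Proof.
move=> linL cL.
pose L' : {linear V -> W} := HB.pack L (GRing.isLinear.Build _ _ _ _ _ linL).
exact: (@linear_differentiable _ _ _ L').
Qed.

Lemma derive_linear V (f : V -> R) (v x : V) :
  linear (f : V -> R^o) -> continuous f -> 'D_v f x = f v.
Proof.
move=> linf cf.
pose f' : {linear V -> R^o} := HB.pack (f : V -> R^o) (GRing.isLinear.Build _ _ _ _ _ linf).
rewrite deriveE; last exact: differentiable_linear.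
by rewrite (@diff_lin _ _ _ f').
Qed.

Lemma Ck_comp_linear V W (L : V -> W) k (f : W -> R) :
  linear L -> continuous L -> Ck k f -> Ck k (f \o L).
Proof.
move=> linL cL; elim: k f => [|k IH] f /=.
  by move=> cf x; apply: continuous_comp; [exact: cL|exact: cf].
move=> [df cf]; split=> [x|v].
  by apply: differentiable_comp => //; exact: differentiable_linear.
rewrite (_ : 'D_v _ = 'D_(L v) f \o L); first exact: IH.
by apply/funext => x; exact: derive_comp_linear.
Qed.

Lemma Ck_cst V k (c : R) : Ck k (fun _ : V => c).
Proof.
elim: k c => [|k IH] c /=; first exact: cst_continuous.
split=> [x|v]; first exact: differentiable_cst.
by rewrite (_ : 'D_v _ = fun=> 0) //; apply/funext => x; exact: derive_cst.
Qed.

Lemma Ck_linear V k (f : V -> R) :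
  linear (f : V -> R^o) -> continuous f -> Ck k f.
Proof.
move=> linf cf; case: k => [|k] //=.
split=> [x|v]; first exact: differentiable_linear.
rewrite (_ : 'D_v _ = fun=> f v); first exact: Ck_cst.
by apply/funext => x; exact: derive_linear.
Qed.

Lemma CkB V k (f g : V -> R) : Ck k f -> Ck k g -> Ck k (fun x => f x - g x).
Proof.
elim: k f g => [|k IH] f g /=.
  by move=> cf cg x; apply: cvgB; [exact: cf|exact: cg].
move=> [df cf] [dg cg]; split=> [x|v]; first exact: differentiableB.
rewrite (_ : 'D_v _ = fun x => 'D_v f x - 'D_v g x); first exact: IH.
by apply/funext => x; apply: deriveB; exact: diff_derivable.
Qed.

(** Linearity of the derivative in the direction, applied twice. The mixed derivatives stay
    separate, as in [levi_form_direction]. *)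
Lemma derive2Dl V (f : V -> R) (x v w : V) (a : R) : Ck 2 f ->
  'D_(v + a *: w) ('D_(v + a *: w) f) x =
  'D_v ('D_v f) x + a * ('D_v ('D_w f) x + 'D_w ('D_v f) x)
  + a ^+ 2 * 'D_w ('D_w f) x.
Proof.
move=> [df d2f].
have dd z y : differentiable ('D_z f) y by have [] := d2f z.
have E : 'D_(v + a *: w) f = 'D_v f + a *: 'D_w f.
  by apply/funext => y; rewrite deriveDl.
have der z y : 'D_y ('D_(v + a *: w) f) z = 'D_y ('D_v f) z + a * 'D_y ('D_w f) z.
  rewrite E deriveD; [|exact: diff_derivable|exact/derivableZ/diff_derivable].
  by rewrite deriveZ //; exact: diff_derivable.
transitivity ('D_v ('D_(v + a *: w) f) x + a * 'D_w ('D_(v + a *: w) f) x).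
  exact: deriveDl (dd _ _).
have alg (p r s t : R) :
    p + a * r + a * (s + a * t) = p + a * (r + s) + a ^+ 2 * t by ring.
by rewrite !der alg.
Qed.

(** Difference quotients in [t] along the line are those of the derivative along [v]; this links
    directional derivatives to [jet2]. *)
Lemma jet2_line V (f : V -> R) (q v : V) : Ck 2 f ->
  jet2 (fun t => f (q + t *: v)) ('D_v f q) ('D_v ('D_v f) q).
Proof.
have along (g : V -> R) (t : R) : differentiable g (q + t *: v) ->
    is_derive t 1 (fun t => g (q + t *: v)) ('D_v g (q + t *: v)).
  move=> /(@diff_derivable _ _ _ _ _ v).
  have E : (fun h : R => h^-1 *:
      (((fun t => g (q + t *: v)) \o shift t) (h *: 1) - g (q + t *: v))) =
      (fun h => h^-1 *: ((g \o shift (q + t *: v)) (h *: v) - g (q + t *: v))).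
    apply/funext => h /=; rewrite [_ *: 1]mulr1 scalerDl.
    by rewrite addrCA.
  move=> dg; apply: DeriveDef; first by rewrite /derivable E.
  by rewrite /derive E.
move=> [df /(_ v) [ddf _]]; exists (fun t => 'D_v f (q + t *: v)).
  by near=> t; exact: along.
split; first by rewrite scale0r addr0.
by have := along _ 0 (ddf _); rewrite scale0r addr0.
Unshelve. all: by end_near. Qed.

End Ck.

(** * Wirtinger derivatives in real coordinates *)

Lemma to_realK {R : realType} {N : nat} : cancel (@to_real R N) (@of_real R N).
Proof.
move=> p; apply/rowP => j; rewrite !mxE /=; by case: (p 0 j).
Qed.

Lemma of_realK {R : realType} {N : nat} : cancel (@of_real R N) (@to_real R N).
Proof.
by move=> [a b]; rewrite /to_real; congr (_, _); apply/rowP => j; rewrite !mxE.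
Qed.

Lemma to_real_delta {R : realType} {N : nat} (j : 'I_N) :
  to_real (delta_mx 0 j : 'rV[R[i]]_N) = (delta_mx 0 j, 0).
Proof.
by rewrite /to_real; congr (_, _); apply/rowP => k; rewrite !mxE eqxx /=; case: (k == j).
Qed.

Lemma to_real_idelta {R : realType} {N : nat} (j : 'I_N) :
  to_real ('i%C *: delta_mx 0 j : 'rV[R[i]]_N) = (0, delta_mx 0 j).
Proof.
by rewrite /to_real; congr (_, _); apply/rowP => k; rewrite !mxE eqxx andTb;
  case: (k == j); rewrite ?mulr1 ?mulr0.
Qed.

Section WirtingerReal.
Context {R : realType} {N : nat}.
Variable r : 'rV[R[i]]_N -> R.
Let s := r \o @of_real R N.

Lemma rderive_cplx_fun v p :
  rderive v (cplx_fun r) p = ('D_(to_real v) s (to_real p))%:C.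
Proof. by rewrite /rderive /cplx_fun /= derive_cst. Qed.

Lemma div2_complex (z : R[i]) : z / 2 = (complex.Re z / 2) +i* (complex.Im z / 2).
Proof.
have two : (2 : R[i]) = (2 : R)%:C by rewrite rmorphD /=.
rewrite two -fmorphV.
by case: z => a b; simpc.
Qed.

Lemma d_z_real j p : d_z j (cplx_fun r) p =
  ('D_(delta_mx 0 j, 0) s (to_real p) / 2) +i*
  (- 'D_(0, delta_mx 0 j) s (to_real p) / 2).
Proof.
rewrite /d_z !rderive_cplx_fun to_real_delta to_real_idelta div2_complex.
by simpc.
Qed.

Lemma d_zbar_real j p : d_zbar j (cplx_fun r) p =
  ('D_(delta_mx 0 j, 0) s (to_real p) / 2) +i*
  ('D_(0, delta_mx 0 j) s (to_real p) / 2).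
Proof.
rewrite /d_zbar !rderive_cplx_fun to_real_delta to_real_idelta div2_complex.
by simpc.
Qed.

Lemma rderive_d_zbar k v p : Ck 2 s ->
  rderive v (d_zbar k (cplx_fun r)) p =
  ('D_(to_real v) ('D_(delta_mx 0 k, 0) s) (to_real p) / 2) +i*
  ('D_(to_real v) ('D_(0, delta_mx 0 k) s) (to_real p) / 2).
Proof.
move=> [_ ds].
have half (f : 'rV[R]_N * 'rV[R]_N -> R) w q : Ck 1 f ->
    'D_w (fun x => f x / 2) q = 'D_w f q / 2.
  move=> [df _]; rewrite (_ : (fun x => f x / 2) = 2^-1 *: f); last first.
    by apply/funext => x /=; rewrite mulrC.
  by rewrite deriveZ; [rewrite [LHS]mulrC|exact: diff_derivable].
have ReE : (fun q => complex.Re (d_zbar k (cplx_fun r) (of_real q))) =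
    (fun q => 'D_(delta_mx 0 k, 0) s q / 2).
  by apply/funext => q; rewrite d_zbar_real of_realK.
have ImE : (fun q => complex.Im (d_zbar k (cplx_fun r) (of_real q))) =
    (fun q => 'D_(0, delta_mx 0 k) s q / 2).
  by apply/funext => q; rewrite d_zbar_real of_realK.
rewrite /rderive ReE ImE.
congr (_ +i* _); first exact: (half _ _ _ (ds (delta_mx 0 k, 0))).
exact: (half _ _ _ (ds (0, delta_mx 0 k))).
Qed.

Lemma d_z_d_zbar_real j k p : Ck 2 s ->
  let D v w := 'D_v ('D_w s) (to_real p) in
  let x i := (delta_mx 0 i, 0) : 'rV[R]_N * 'rV[R]_N in
  let y i := (0, delta_mx 0 i) : 'rV[R]_N * 'rV[R]_N in
  d_z j (d_zbar k (cplx_fun r)) p =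
  ((D (x j) (x k) + D (y j) (y k)) / 4) +i*
  ((D (x j) (y k) - D (y j) (x k)) / 4).
Proof.
have E (a b c d : R) : ((a / 2 +i* (b / 2)) - 'i%C * (c / 2 +i* (d / 2))) / 2 =
    ((a + d) / 4) +i* ((b - c) / 4).
  by rewrite div2_complex; simpc; congr (_ +i* _); rewrite /=; field.
move=> s2 D x y; rewrite /d_z !(rderive_d_zbar _ _ _ s2) to_real_delta to_real_idelta.
by rewrite E.
Qed.

End WirtingerReal.

(** * The Levi form of a graph *)

Section Slice.
Context {R : realType} {m : nat}.
Let V1 : normedModType R := ('rV[R]_(m + 1) * 'rV[R]_(m + 1))%type.
Let V2 : normedModType R := ('rV[R]_m * 'rV[R]_m * R)%type.

(** The projection of [(z, w)] to [(Re z, Im z, Re w)], not one of the slices [S_z]. Together with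
    [height], which is [Im w], it writes the defining function of the graph through linear maps and
    [f]. *)
Definition slice (q : 'rV[R]_(m + 1) * 'rV[R]_(m + 1)) : 'rV[R]_m * 'rV[R]_m * R :=
  (lsubmx q.1, lsubmx q.2, q.1 0 (rshift m ord0)).

Fact slice_is_linear :
  linear (slice : V1 -> V2).
Proof.
move=> a q q'; rewrite /slice.
congr (_, _, _); last by rewrite !mxE.
- by apply/matrixP => i j; rewrite !mxE.
- by apply/matrixP => i j; rewrite !mxE.
Qed.

Definition height (q : 'rV[R]_(m + 1) * 'rV[R]_(m + 1)) : R :=
  q.2 0 (rshift m ord0).

Fact height_is_linear : linear (height : V1 -> R^o).
Proof. by move=> a q q'; rewrite /height !mxE. Qed.

Definition vertical (u : R) : 'rV[R]_m * 'rV[R]_m * R := (0, 0, u).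

Fact vertical_is_linear :
  linear (vertical : R -> V2).
Proof.
by move=> a u u'; congr (_, _, _); rewrite /= scaler0 addr0.
Qed.

Lemma slice_continuous : continuous slice.
Proof.
move=> q; apply: differentiable_continuous.
have dfst : differentiable (fst : 'rV[R]_(m + 1) * 'rV[R]_(m + 1) -> _) q.
  by apply: linear_differentiable => q'; exact: cvg_fst.
have dsnd : differentiable (snd : 'rV[R]_(m + 1) * 'rV[R]_(m + 1) -> _) q.
  by apply: linear_differentiable => q'; exact: cvg_snd.
have d1 : differentiable (fun q : 'rV[R]_(m + 1) * 'rV[R]_(m + 1) =>
    lsubmx q.1 : 'rV[R]_m) q.
  exact: (differentiable_comp dfst (differentiable_lsubmx _)).
have d2 : differentiable (fun q : 'rV[R]_(m + 1) * 'rV[R]_(m + 1) =>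
    lsubmx q.2 : 'rV[R]_m) q.
  exact: (differentiable_comp dsnd (differentiable_lsubmx _)).
have d3 : differentiable (fun q : 'rV[R]_(m + 1) * 'rV[R]_(m + 1) =>
    q.1 0 (rshift m ord0)) q.
  exact: (differentiable_comp dfst (differentiable_coord _ _ _)).
exact: (differentiable_pair (differentiable_pair d1 d2) d3).
Qed.

Lemma height_continuous : continuous height.
Proof.
move=> q; apply: differentiable_continuous.
have dsnd : differentiable (snd : 'rV[R]_(m + 1) * 'rV[R]_(m + 1) -> _) q.
  by apply: linear_differentiable => q'; exact: cvg_snd.
exact: (differentiable_comp dsnd (differentiable_coord _ _ _)).
Qed.

Lemma vertical_continuous : continuous vertical.
Proof.
move=> u; apply: differentiable_continuous.
by apply: differentiable_pair; [exact: differentiable_cst|].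
Qed.

End Slice.

Section GraphLevi.
Context {R : realType} {m : nat}.
Variable rho : 'rV[R[i]]_m -> R -> R.
Hypothesis rho_smooth : smooth_on_CxR rho.
Let f := fun q : 'rV[R]_m * 'rV[R]_m * R => rho (of_real q.1) q.2.

Definition graph_fun (p : 'rV[R[i]]_(m + 1)) : R :=
  complex.Im (wpart p) - rho (zpart p) (complex.Re (wpart p)).

Lemma graph_fun_real :
  graph_fun \o @of_real R _ = fun q => height q - f (slice q).
Proof.
apply/funext => q; rewrite /graph_fun /= /height /f /slice /wpart /zpart !mxE /=.
by congr (_ - rho _ _); apply/rowP => j; rewrite !mxE.
Qed.

Lemma smooth_graph_fun : smooth_on_C graph_fun.
Proof.
rewrite /smooth_on_C graph_fun_real => k; apply: CkB.
  by apply: Ck_linear; [exact: height_is_linear|exact: height_continuous].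
exact: (Ck_comp_linear slice_is_linear slice_continuous (rho_smooth k)).
Qed.

Lemma derive_graph_fun v q :
  'D_v (graph_fun \o @of_real R _) q = height v - 'D_(slice v) f (slice q).
Proof.
rewrite graph_fun_real.
have [df _] := rho_smooth 1.
have dh := diff_derivable (v:=v) (differentiable_linear q height_is_linear height_continuous).
have ds : derivable (f \o slice) q v.
  apply: diff_derivable; apply: differentiable_comp; last exact: df.
  exact: (differentiable_linear q slice_is_linear slice_continuous).
rewrite -(derive_linear v q height_is_linear height_continuous).
rewrite -(derive_comp_linear f v q slice_is_linear).
exact: (deriveB dh ds).
Qed.

Lemma derive2_graph_fun v w q :
  'D_v ('D_w (graph_fun \o @of_real R _)) q =
    - 'D_(slice v) ('D_(slice w) f) (slice q).
Proof.
have -> : 'D_w (graph_fun \o @of_real R _) =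
    (fun q => height w - 'D_(slice w) f (slice q)).
  by apply/funext => q'; exact: derive_graph_fun.
have [_ /(_ (slice w)) [df _]] := rho_smooth 2.
have ds : derivable ('D_(slice w) f \o slice) q v.
  apply: diff_derivable; apply: differentiable_comp; last exact: df.
  exact: (differentiable_linear q slice_is_linear slice_continuous).
rewrite -(derive_comp_linear ('D_(slice w) f) v q slice_is_linear) -[RHS]sub0r.
rewrite -(derive_cst (height w) q v).
exact: (deriveB (derivable_cst (height w) q v) ds).
Qed.

End GraphLevi.

Section SliceDelta.
Context {R : realType} {m : nat}.
Implicit Type j : 'I_m.
Let V2 := ('rV[R]_m * 'rV[R]_m * R)%type.

Lemma slice_xl j : slice (delta_mx 0 (lshift 1 j), 0) = (delta_mx 0 j, 0, 0) :> V2.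
Proof.
rewrite /slice /= linear0 mxE eqxx eq_rlshift; congr (_, _, _).
by apply/rowP => k; rewrite !mxE eq_lshift.
Qed.

Lemma slice_yl j : slice (0, delta_mx 0 (lshift 1 j)) = (0, delta_mx 0 j, 0) :> V2.
Proof.
rewrite /slice /= linear0 mxE; congr (_, _, _).
by apply/rowP => k; rewrite !mxE eq_lshift.
Qed.

Lemma slice_xr : slice (delta_mx 0 (rshift m ord0), 0) = (0, 0, 1) :> V2.
Proof.
rewrite /slice /= linear0 mxE !eqxx; congr (_, _, _).
by apply/rowP => k; rewrite !mxE eq_lrshift.
Qed.

Lemma slice_yr : slice (0, delta_mx 0 (rshift m ord0)) = (0, 0, 0) :> V2.
Proof.
rewrite /slice /= linear0 mxE; congr (_, _, _).
by apply/rowP => k; rewrite !mxE eq_lrshift.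
Qed.

Lemma height_x i : height ((delta_mx 0 i, 0) : 'rV[R]_(m + 1) * 'rV[R]_(m + 1)) = 0.
Proof. by rewrite /height mxE. Qed.

Lemma height_yl j :
  height ((0, delta_mx 0 (lshift 1 j)) : 'rV[R]_(m + 1) * 'rV[R]_(m + 1)) = 0.
Proof. by rewrite /height mxE eq_rlshift. Qed.

Lemma height_yr :
  height ((0, delta_mx 0 (rshift m ord0)) : 'rV[R]_(m + 1) * 'rV[R]_(m + 1)) = 1.
Proof. by rewrite /height mxE !eqxx. Qed.

End SliceDelta.

(** The vector [(e_j, a)] has at most two nonzero entries. The map [g] stands for the identity or
    for conjugation, the two ways in which it enters the Levi form. *)
Lemma sum_row_delta_const {C : comNzRingType} {m : nat} (c : 'I_(m + 1) -> C)
    (g : C -> C) (j : 'I_m) (a : C) : g 0 = 0 -> g 1 = 1 ->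
  \sum_i c i * g ((row_mx (delta_mx 0 j) (const_mx a) : 'rV_(m + 1)) 0 i) =
  c (lshift 1 j) + c (rshift m ord0) * g a.
Proof.
move=> g0 g1; rewrite big_split_ord big_ord1 /= row_mxEr mxE; congr (_ + _).
rewrite (bigD1 j) //= big1 ?addr0 => [|k kj].
  by rewrite row_mxEl mxE !eqxx g1 mulr1.
by rewrite row_mxEl mxE (negPf kj) andbF g0 mulr0.
Qed.

Lemma sesquilinear_direction {R : rcfType} {m : nat}
    (H : 'I_(m + 1) -> 'I_(m + 1) -> R[i]) (j : 'I_m) (a : R[i]) :
  let t : 'rV_(m + 1) := row_mx (delta_mx 0 j) (const_mx a) in
  \sum_k \sum_l H k l * t 0 k * ((t 0 l)^*)%C =
  H (lshift 1 j) (lshift 1 j) + H (lshift 1 j) (rshift m ord0) * (a^*)%C +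
  (H (rshift m ord0) (lshift 1 j) + H (rshift m ord0) (rshift m ord0) * (a^*)%C) * a.
Proof.
move=> t.
have c0 : ((0 : R[i])^*)%C = 0 by exact: rmorph0.
have c1 : ((1 : R[i])^*)%C = 1 by exact: rmorph1.
rewrite -(sum_row_delta_const (fun k => H k (lshift 1 j) +
  H k (rshift m ord0) * (a^*)%C) (g := id) j a) //.
apply: eq_bigr => k _.
rewrite (sum_row_delta_const (fun l => H k l * t 0 k) (g := @conjc R) j a c0 c1).
by rewrite [X in _ + X]mulrAC -mulrDl.
Qed.

(* In the next two lemmas the left-hand sides keep the shape produced by
   [derive_graph_fun] and [derive2_graph_fun] for
   [height - f \o slice], zeros included. *)
Lemma tangent_direction {R : rcfType} (rX rY rW a c : R) :
  c = - (rX + a * rW) -> a = rY + c * rW ->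
  ((0 - rX) / 2 +i* (- (0 - rY) / 2)) +
    ((0 - rW) / 2 +i* (- (1 - 0) / 2)) * (a +i* (- c)) = 0.
Proof.
move=> cE aE; simpc; congr (_ +i* _).
- by rewrite cE; field.
- by rewrite [in X in _ + X]aE; field.
Qed.

Lemma levi_form_direction {R : rcfType} (XX XY YX YY XW YW WX WY WW a c : R) :
  ((- XX + - YY) / 4 +i* ((- XY - - YX) / 4)) +
    ((- XW + - 0) / 4 +i* ((- 0 - - YW) / 4)) * ((a +i* (- c))^*)%C +
  (((- WX + - 0) / 4 +i* ((- WY - - 0) / 4)) +
    ((- WW + - 0) / 4 +i* ((- 0 - - 0) / 4)) * ((a +i* (- c))^*)%C) * (a +i* (- c)) = 0 ->
  XX + a * (XW + WX) + a ^+ 2 * WW + (YY + c * (YW + WY) + c ^+ 2 * WW) = 0.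
Proof.
(* The claim is [- 4] times the real part. *)
simpc => -[/(congr1 (fun x => - 4 * x))]; rewrite mulr0 => <- _; by field.
Qed.

Section LeviFlatGraph.
Context {R : realType} {m : nat}.
Variable rho : 'rV[R[i]]_m -> R -> R.
Hypothesis rho_smooth : smooth_on_CxR rho.
Hypothesis rho_flat : levi_flat (graph rho).
Let f := fun q : 'rV[R]_m * 'rV[R]_m * R => rho (of_real q.1) q.2.

Lemma graph_defining_function : defining_function (graph rho) (graph_fun rho).
Proof.
split; first exact: smooth_graph_fun.
  by apply/seteqP; split=> p /=; rewrite /graph /graph_fun /= => /eqP E; apply/eqP;
    rewrite subr_eq0 in E *.
(* The derivative in [w] has imaginary part [- 1/2], coming from the term [Im w]. *)
move=> p _; exists (rshift m ord0).
rewrite d_z_real (derive_graph_fun rho_smooth) (derive_graph_fun rho_smooth).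
rewrite height_yr slice_yr (derive0 _ _) subr0.
by apply/eqP => -[_]; lra.
Qed.

(** The vector [t = (e_j, a - i c)] is complex tangent, and [v], [w] are the projections of [t] and
    [i t] to the [(z, u)] space. Tangency makes the first derivatives of [f] the [Im w] components
    of [t] and [i t]; the two second derivatives add up to [- 4] times the Levi form at [t]. *)
Lemma levi_flat_graph_eq (j : 'I_m) (q : 'rV[R]_m * 'rV[R]_m * R) :
  exists a c : R,
    let v : 'rV[R]_m * 'rV[R]_m * R := (delta_mx 0 j, 0, 0) + a *: (0, 0, 1) in
    let w : 'rV[R]_m * 'rV[R]_m * R := (0, delta_mx 0 j, 0) + c *: (0, 0, 1) in
    [/\ 'D_v f q = - c, 'D_w f q = a &
      'D_v ('D_v f) q + 'D_w ('D_w f) q = 0].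
Proof.
pose X : 'rV[R]_m * 'rV[R]_m * R := (delta_mx 0 j, 0, 0).
pose Y : 'rV[R]_m * 'rV[R]_m * R := (0, delta_mx 0 j, 0).
pose W : 'rV[R]_m * 'rV[R]_m * R := (0, 0, 1).
have [df _] := rho_smooth 1.
pose rX : R := 'D_X f q; pose rY : R := 'D_Y f q; pose rW : R := 'D_W f q.
have D0 : 1 + rW ^+ 2 != 0 by rewrite gt_eqF // ltr_wpDr ?sqr_ge0.
(* Solution of the tangency system [a = rY + c * rW], [c = - (rX + a * rW)], whose determinant is
   [1 + rW ^+ 2]. *)
pose a : R := (rY - rX * rW) / (1 + rW ^+ 2).
pose c : R := - (rX + a * rW).
have aE : rY + c * rW = a.
  by rewrite /c /a; field.
exists a, c => v w; split.
- by rewrite /v (@deriveDl _ _ f q X W a (df q)) /c opprK.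
- by rewrite /w (@deriveDl _ _ f q Y W c (df q)) -[RHS]aE.
pose x : 'rV[R]_(m + 1) * 'rV[R]_(m + 1) :=
  (row_mx q.1.1 (const_mx q.2), row_mx q.1.2 (const_mx (f q))).
have sx : slice x = q.
  rewrite /slice /= !row_mxKl row_mxEr mxE.
  by case: (q) => -[].
pose p := of_real x.
have Sp : graph rho p.
  have [_ -> _] := graph_defining_function.
  rewrite /= -[graph_fun rho p]/((graph_fun rho \o @of_real R _) x) graph_fun_real.
  by rewrite sx /height row_mxEr mxE subrr.
have px : to_real p = x by exact: of_realK.
pose t : 'rV[R[i]]_(m + 1) := row_mx (delta_mx 0 j) (const_mx (a +i* (- c))).
have tang : complex_tangent (graph_fun rho) p t.
  rewrite /complex_tangent /=.
  rewrite (sum_row_delta_const (fun i => d_z i (cplx_fun (graph_fun rho)) p)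
    (g := id)) //.
  rewrite !d_z_real px !(derive_graph_fun rho_smooth) sx.
  rewrite !height_x height_yl height_yr slice_xl slice_yl slice_xr slice_yr.
  rewrite (derive0 _ _) -/X -/Y -/W -/f -/rX -/rY -/rW.
  exact: tangent_direction.
have := rho_flat.2 _ graph_defining_function p t Sp tang.
pose B z z' : R := 'D_z ('D_z' f) q.
(* [slice] kills the [Im w] direction, so zero arguments of [B] occur in the Levi matrix. *)
have B0l z : B (0, 0, 0) z = 0 by exact: derive0.
have B0r z : B z (0, 0, 0) = 0.
  rewrite /B (_ : 'D_(0, 0, 0) f = cst 0); first exact: derive_cst.
  by apply/funext => q'; exact: derive0.
have -> : 'D_v ('D_v f) q = B X X + a * (B X W + B W X) + a ^+ 2 * B W W.
  exact: (@derive2Dl _ _ f q X W a (rho_smooth 2)).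
have -> : 'D_w ('D_w f) q = B Y Y + c * (B Y W + B W Y) + c ^+ 2 * B W W.
  exact: (@derive2Dl _ _ f q Y W c (rho_smooth 2)).
pose ex i : 'rV[R]_(m + 1) * 'rV[R]_(m + 1) := (delta_mx 0 i, 0).
pose ey i : 'rV[R]_(m + 1) * 'rV[R]_(m + 1) := (0, delta_mx 0 i).
have LE k l : d_z k (d_zbar l (cplx_fun (graph_fun rho))) p =
    ((- B (slice (ex k)) (slice (ex l)) + - B (slice (ey k)) (slice (ey l))) / 4) +i*
    ((- B (slice (ex k)) (slice (ey l)) - - B (slice (ey k)) (slice (ex l))) / 4).
  have D2 z z' : 'D_z ('D_z' (graph_fun rho \o @of_real R _)) (to_real p) =
      - B (slice z) (slice z').
    by rewrite px (derive2_graph_fun rho_smooth z z' x) sx.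
  have F (a1 a2 a3 a4 b1 b2 b3 b4 : R) : a1 = b1 -> a2 = b2 -> a3 = b3 -> a4 = b4 ->
      ((a1 + a2) / 4) +i* ((a3 - a4) / 4) = ((b1 + b2) / 4) +i* ((b3 - b4) / 4).
    by move=> -> -> -> ->.
  apply: etrans (d_z_d_zbar_real k l p (smooth_graph_fun rho_smooth 2)) _.
  exact: (F _ _ _ _ _ _ _ _ (D2 _ _) (D2 _ _) (D2 _ _) (D2 _ _)).
have -> : levi_form (graph_fun rho) p t = \sum_k \sum_l
    (((- B (slice (ex k)) (slice (ex l)) + - B (slice (ey k)) (slice (ey l))) / 4) +i*
    ((- B (slice (ex k)) (slice (ey l)) - - B (slice (ey k)) (slice (ex l))) / 4)) *
    t 0 k * ((t 0 l)^*)%C.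
  by apply: eq_bigr => k _; apply: eq_bigr => l _; rewrite LE.
clear LE; clearbody B.
rewrite (sesquilinear_direction (fun k l => _ +i* _)) /ex /ey.
rewrite slice_xl slice_yl slice_xr slice_yr -/X -/Y -/W !B0l !B0r.
exact: levi_form_direction.
Qed.

End LeviFlatGraph.

(** * Restriction to coordinate complex lines, and the theorem *)

Lemma complex_line_continuous {R : realType} {m : nat} (a0 b0 d : 'rV[R]_m) :
  continuous (fun q : R * R * R =>
    (a0 + q.1.1 *: d, b0 + q.1.2 *: d, q.2) : 'rV[R]_m * 'rV[R]_m * R).
Proof.
move=> q.
have c1 : (fun q : R * R * R => a0 + q.1.1 *: d) @ q --> a0 + q.1.1 *: d.
  apply: cvgD; first exact: cvg_cst.
  by apply: cvgZr_tmp; apply: (cvg_comp fst fst); exact: cvg_fst.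
have c2 : (fun q : R * R * R => b0 + q.1.2 *: d) @ q --> b0 + q.1.2 *: d.
  apply: cvgD; first exact: cvg_cst.
  by apply: cvgZr_tmp; apply: (cvg_comp fst snd); [exact: cvg_fst|exact: cvg_snd].
have /(_ _ _ _) c12 := cvg_pair c1 c2.
have c3 : (fun q : R * R * R => q.2) @ q --> q.2 by exact: cvg_snd.
have /(_ _ _ _) c123 := cvg_pair c12 c3.
exact: c123.
Qed.

Section Constant.
Context {R : realType} {m : nat}.
Variable rho : 'rV[R[i]]_m -> R -> R.
Hypothesis rho_smooth : smooth_on_CxR rho.
Hypothesis rho_flat : levi_flat (graph rho).
Variable M : R.
Hypothesis rho_bounded : forall z u, `|rho z u| <= M.
Let f := fun q : 'rV[R]_m * 'rV[R]_m * R => rho (of_real q.1) q.2.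

Lemma constant_along_coordinate (j : 'I_m) (a0 b0 : 'rV[R]_m) (x y u : R) :
  f (a0 + x *: delta_mx 0 j, b0 + y *: delta_mx 0 j, u) = f (a0, b0, u).
Proof.
pose g x y u := f (a0 + x *: delta_mx 0 j, b0 + y *: delta_mx 0 j, u).
rewrite -/(g x y u).
have -> : f (a0, b0, u) = g 0 0 u by rewrite /g !scale0r !addr0.
apply: (@flat_bounded_graph_constant _ g M) => [|x' y' u'|x' y' u'].
- have fc : continuous f := rho_smooth 0.
  pose L := fun q : R * R * R => (a0 + q.1.1 *: delta_mx 0 j,
    b0 + q.1.2 *: delta_mx 0 j, q.2) : 'rV[R]_m * 'rV[R]_m * R.
  have Lc : continuous L by exact: complex_line_continuous.
  move=> q; exact: (@continuous_comp _ _ _ L f q (Lc q) (fc (L q))).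
- have [a [c [Dv Dw Levi]]] := levi_flat_graph_eq rho_smooth rho_flat j
    (a0 + x' *: delta_mx 0 j, b0 + y' *: delta_mx 0 j, u').
  have jv := jet2_line (a0 + x' *: delta_mx 0 j, b0 + y' *: delta_mx 0 j, u')
    ((delta_mx 0 j, 0, 0) + a *: (0, 0, 1)) (rho_smooth 2).
  have jw := jet2_line (a0 + x' *: delta_mx 0 j, b0 + y' *: delta_mx 0 j, u')
    ((0, delta_mx 0 j, 0) + c *: (0, 0, 1)) (rho_smooth 2).
  rewrite Dv in jv; rewrite Dw in jw.
  (* The vanishing sum turns the second derivative along [w] into the [- b] of the flatness
     hypothesis. *)
  move: Levi => /eqP; rewrite addrC addr_eq0 => /eqP Levi; rewrite Levi in jw.
  exists a, c; eexists; split.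
  + rewrite (_ : (fun t => _) = (fun t => f ((a0 + x' *: delta_mx 0 j,
      b0 + y' *: delta_mx 0 j, u') + t *: ((delta_mx 0 j, 0, 0) + a *: (0, 0, 1))))).
      exact: jv.
    apply/funext => t; rewrite /g; congr (f (_, _, _)) => /=.
    * by rewrite scaler0 addr0 scalerDl addrA.
    * by rewrite scaler0 addr0 scaler0 addr0.
    * by rewrite add0r [a *: _]mulr1 [t *: _]mulrC.
  + rewrite (_ : (fun t => _) = (fun t => f ((a0 + x' *: delta_mx 0 j,
      b0 + y' *: delta_mx 0 j, u') + t *: ((0, delta_mx 0 j, 0) + c *: (0, 0, 1))))).
      exact: jw.
    apply/funext => t; rewrite /g; congr (f (_, _, _)) => /=.
    * by rewrite scaler0 addr0 scaler0 addr0.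
    * by rewrite scaler0 addr0 scalerDl addrA.
    * by rewrite add0r [c *: _]mulr1 [t *: _]mulrC.
- exact: rho_bounded.
Qed.

Lemma constant_in_z (z : 'rV[R[i]]_m) (u : R) : rho z u = rho 0 u.
Proof.
(* The point [z] is expanded in the standard basis and its coordinates are removed one at a time;
   the base point varies in the induction. *)
have sums (s : seq 'I_m) (x y : 'I_m -> R) (a0 b0 : 'rV[R]_m) :
    f (a0 + \sum_(i <- s) x i *: delta_mx 0 i, b0 + \sum_(i <- s) y i *: delta_mx 0 i, u) =
    f (a0, b0, u).
  elim: s a0 b0 => [|i s IH] a0 b0; first by rewrite !big_nil !addr0.
  by rewrite !big_cons !addrA IH constant_along_coordinate.
have fE q : f (q, u) = rho (of_real q) u by [].
have to_real0 : to_real (0 : 'rV[R[i]]_m) = (0, 0).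
  by rewrite /to_real; congr (_, _); apply/rowP => j; rewrite !mxE.
rewrite -(to_realK z) -(to_realK 0) to_real0 -!fE.
case: (to_real z) => x y.
have := sums (index_enum _) (x 0) (y 0) 0 0.
by rewrite !add0r -!row_sum_delta.
Qed.

End Constant.

Theorem theorem2p15 (R : realType) (n : nat) (hn : (2 <= n)%N)
    (rho : 'rV[R[i]]_(n.-1) -> R -> R)
    (rho_smooth : smooth_on_CxR rho)
    (rho_bounded : exists M : R, forall z u, `|rho z u| <= M)
    (S_flat : levi_flat (graph rho)) :
  exists varrho : R -> R,
    [/\ smooth varrho,
        forall z u, rho z u = varrho u &
        graph rho = \bigcup_(u in [set: R]) hyperplane (u +i* varrho u)].
Proof.
have [M rhoM] := rho_bounded.
have rhoE := constant_in_z rho_smooth S_flat rhoM.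
exists (rho 0); split; [|exact: rhoE|].
  have of_real0 : of_real (0 : 'rV[R]_n.-1, 0) = 0.
    by apply/rowP => j; rewrite !mxE.
  (* [rho 0] is the restriction of the smooth function to the line [z = 0]. *)
  move=> k; have := Ck_comp_linear vertical_is_linear vertical_continuous (rho_smooth k).
  rewrite (_ : _ \o _ = rho 0) //.
  by apply/funext => u; rewrite /= of_real0.
apply/seteqP; split=> p; rewrite /graph /hyperplane /=.
  move=> pS; exists (complex.Re (wpart p)) => //=.
  by rewrite -(rhoE (zpart p)) -pS; case: (wpart p).
by move=> [u _ ->] /=; rewrite rhoE.
Qed.
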